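(* Let $P$ be any unital abelian semigroup, let $\mathcal{H}$ be a Hilbert space, and let $T:P\to\mathcal{B}(\mathcal{H})$ be a unital contractive representation of $P$. Then the following are equivalent: (i) There exist a Hilbert space $\mathcal{K}\supseteq\mathcal{H}$ and a map $N:P\to\mathcal{B}(\mathcal{K})$ (not required to be multiplicative) such that each $N(p)$ is a normal contraction, $\{N(p)\}_{p\in P}$ is a commuting family, and $N(p)$ extends $T(p)$ for every $p\in P$. (ii) There exist a Hilbert space $\mathcal{L}\supseteq\mathcal{H}$ and a contractive normal representation $N:P\to\mathcal{B}(\mathcal{L})$ such that $N(p)$ extends $T(p)$ for every $p\in P$.
   Context: A unital semigroup is a semigroup with an identity element $e$. A (unital) representation of a unital semigroup $P$ on a Hilbert space $\mathcal{H}$ is a map $T:P\to\mathcal{B}(\mathcal{H})$ into the bounded operators with $T(e)=I$ and $T(pq)=T(p)T(q)$ for all $p,q\in P$. It is contractive if $\|T(p)\|\le 1$ for all $p\in P$, and normal if every $T(p)$ is a normal operator. For $T\in\mathcal{B}(\mathcal{H})$ and $S\in\mathcal{B}(\mathcal{K})$ with $\mathcal{H}\subseteq\mathcal{K}$ a closed subspace, $S$ extends $T$ if $S\mathcal{H}\subseteq\mathcal{H}$ and $S|_{\mathcal{H}}=T$. *)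

(* Defs.v *)
From HB Require Import structures.
From mathcomp Require Import all_boot all_order all_algebra.
From mathcomp Require Import complex.
From mathcomp Require Import boolp classical_sets reals topology normedtype.

Set Implicit Arguments.
Unset Strict Implicit.
Unset Printing Implicit Defensive.

Import Order.TTheory GRing.Theory Num.Theory.
Import numFieldNormedType.Exports.

Local Open Scope classical_set_scope.
Local Open Scope ring_scope.

(* Complex Hilbert spaces: Banach spaces over R[i] whose norm comes from an
   inner product, which is linear in its first argument. *)
HB.mixin Record NormedModule_isHilbert (R : realType) H
    of CompleteNormedModule R[i] H := {
  inner : {dot H for (@Num.conj R[i])} ;
  sqr_norm_inner : forall x : H, `|x| ^+ 2 = inner x x
}.

#[short(type="hilbertType")]
HB.structure Definition Hilbert (R : realType) :=
  {H of NormedModule_isHilbert R H & CompleteNormedModule R[i] H}.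

Arguments inner {R} s.

Record bounded_operator (R : realType) (H : hilbertType R) := BoundedOperator {
  bounded_operator_fun :> {linear H -> H} ;
  bounded_operatorP :
    exists M : R[i], forall x, `|bounded_operator_fun x| <= M * `|x|
}.

Section Operators.
Variables (R : realType) (H : hilbertType R).
Implicit Types A B : bounded_operator H.

(* Norms of vectors are complex numbers with zero imaginary part. *)
Definition opnorm A : R :=
  sup [set complex.Re `|A x| | x in [set x : H | `|x| <= 1]].

Definition contraction A := opnorm A <= 1.

Definition is_adjoint A B := forall x y, inner H (A x) y = inner H x (B y).

(* The adjoint exists (Riesz) and is unique, so B below is the adjoint of A. *)
Definition normal_operator A :=
  exists B, is_adjoint A B /\ A \o B =1 B \o A.

End Operators.

Section Representations.
Variables (R : realType) (P : monoidType) (H : hilbertType R).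
Implicit Type T : P -> bounded_operator H.

Definition representation T :=
  T 1%g =1 id /\ forall p q, T (p * q)%g =1 T p \o T q.

Definition contractive T := forall p, contraction (T p).

Definition normal_family T := forall p, normal_operator (T p).

Definition commuting_family T := forall p q, T p \o T q =1 T q \o T p.

End Representations.

(* The inclusion of H in K is an inner product preserving linear map V; its
   range is closed since H is complete.  [extends V A S] says that S maps
   V(H) into itself and acts on it as A. *)
Definition inclusion (R : realType) (H K : hilbertType R)
    (V : {linear H -> K}) := isometry (inner K) (inner H) V.

Definition extends (R : realType) (H K : hilbertType R) (V : {linear H -> K})
    (A : bounded_operator H) (S : bounded_operator K) :=
  forall h, S (V h) = V (A h).

(* Main.v *)
(* Let L be the set of x in K with N(1)x = x and N(pq)x = N(p)N(q)x for all p
   and q.  It is a closed subspace containing H, and the restriction of N to L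
   is multiplicative.  By Fuglede's theorem each N(p) commutes with each N(q)^*,
   so L is invariant under every N(p) and N(p)^*, hence the restrictions are
   normal.

   Fuglede's theorem (if M is normal and A commutes with M, then A commutes
   with B = M^* ) is proved with binomial powers in place of exponentials.  The
   polynomial F(u) = (1 + uB)^n A (1 - uB)^n y has u-coefficient n(BA - AB)y.
   As 1 + uB is normal and its adjoint commutes with A,
     |F(u)| <= |A| |(1 + uB)^n (1 - uB)^n y| <= |A| (1 + |uB|^2)^n |y|.
   Cauchy's estimate on a circle of radius of order n^(-1/2) then bounds
   n |(BA - AB)y| by a multiple of n^(1/2), for every n. *)
Require Import Defs.
From HB Require Import structures.
From mathcomp Require Import all_boot all_order all_algebra.
From mathcomp Require Import complex cyclic separable cyclotomic.
From mathcomp Require Import ring.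
From mathcomp Require Import boolp classical_sets reals topology normedtype.

Set Implicit Arguments.
Unset Strict Implicit.
Unset Printing Implicit Defensive.

Import Order.TTheory GRing.Theory Num.Theory.
Import numFieldNormedType.Exports.

Local Open Scope classical_set_scope.
Local Open Scope ring_scope.

(** * Roots of unity and a discrete Cauchy estimate *)

(** In characteristic 0 the polynomial X^n - 1 is separable, so it has n distinct roots here, and n
    distinct n-th roots of unity include a primitive one. *)
Lemma closed_prim_root_exists (C : numClosedFieldType) n :
  (0 < n)%N -> exists z : C, n.-primitive_root z.
Proof.
move=> n_gt0; have [r pE] := closed_field_poly_normal ('X^n - 1 : {poly C}).
rewrite (monicP (monicXnsubC 1 n_gt0)) scale1r in pE.
have r_root : all n.-unity_root r.
  by apply/allP => z; rewrite -root_prod_XsubC -pE.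
have r_uniq : uniq r.
  by rewrite -separable_prod_XsubC -pE separable_Xn_sub_1// pnatr_eq0 -lt0n.
have r_size : (n <= size r)%N.
  by rewrite -ltnS -(size_prod_XsubC r id) -pE size_XnsubC.
by have /hasP[z _ zP] := has_prim_root n_gt0 r_root r_uniq r_size; exists z.
Qed.

(** Orthogonality of the characters of Z/N: z = w^(i-k) satisfies z^N = 1, so z - 1 kills the
    geometric sum, and z differs from 1 unless i = k. *)
Lemma sum_prim_root (F : fieldType) N (w : F) i k :
  N.-primitive_root w -> (i < N)%N -> (k < N)%N ->
  \sum_(j < N) (w ^+ i / w ^+ k) ^+ j = (N * (i == k))%:R.
Proof.
move=> w_prim iN kN; have N_gt0 := prim_order_gt0 w_prim.
have wk0 : w ^+ k != 0.
  by rewrite expf_neq0// (prim_root_eq0 w_prim) -lt0n.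
have [->|ik] := eqVneq i k.
  by rewrite divff// (eq_bigr (fun=> 1)) ?sumr_const ?card_ord ?muln1// => j _;
    rewrite expr1n.
set z := w ^+ i / w ^+ k; rewrite muln0.
have z1 : z - 1 != 0.
  rewrite subr_eq0 -(inj_eq (mulIf wk0)) mul1r divfK//.
  by rewrite (eq_prim_root_expr w_prim) !modn_small.
apply: (mulfI z1); rewrite -subrX1 mulr0 expr_div_n -!exprM ![(_ * N)%N]mulnC.
by rewrite !exprM (prim_expr_order w_prim) !expr1n divr1 subrr.
Qed.

(** Discrete form of Cauchy's integral formula: averaging over the N points t w^j with weights
    w^(-jk) isolates the k-th term exactly, because the degree is below N. The triangle inequality
    then bounds it. *)
Lemma cauchy_coef_estimate (C : numClosedFieldType) (V : normedModType C) N
    (v : nat -> V) (t c : C) (k : 'I_N) :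
  0 <= t -> (forall u, `|u| = t -> `|\sum_(i < N) u ^+ i *: v i| <= c) ->
  t ^+ k * `|v k| <= c.
Proof.
move=> t_ge0 vc; have N_gt0 : (0 < N)%N := leq_ltn_trans (leq0n k) (ltn_ord k).
have [w w_prim] := closed_prim_root_exists C N_gt0.
have normw : `|w| = 1.
  by apply: (pexpIrn N_gt0); rewrite ?nnegrE// -normrX
    (prim_expr_order w_prim) normr1 expr1n.
have avg : \sum_(j < N) w ^- (j * k) *: (\sum_(i < N) (w ^+ j * t) ^+ i *: v i)
    = N%:R *: (t ^+ k *: v k).
  transitivity (\sum_(i < N) (N * (i == k :> nat))%:R *: (t ^+ i *: v i)).
    under eq_bigr do rewrite scaler_sumr.
    rewrite exchange_big; apply: eq_bigr => i _ /=.
    rewrite -(sum_prim_root w_prim)// scaler_suml; apply: eq_bigr => j _.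
    rewrite !scalerA; congr (_ *: _).
    by rewrite exprMn expr_div_n -!exprM ![(j * _)%N]mulnC mulrCA mulrA.
  rewrite (bigD1 k)//= eqxx muln1 big1 ?addr0// => i ik.
  by rewrite (negbTE ik : (i == k :> nat) = false) muln0 scale0r.
have : `|N%:R *: (t ^+ k *: v k)| <= c *+ N.
  have -> : c *+ N = \sum_(j < N) c by rewrite sumr_const card_ord.
  rewrite -avg.
  apply: le_trans (ler_norm_sum _ _ _) _; apply: ler_sum => j _.
  rewrite normrZ normrV ?unitfE; last first.
    by rewrite expf_neq0// (prim_root_eq0 w_prim) -lt0n.
  rewrite normrX normw expr1n invr1 mul1r; apply: vc.
  by rewrite normrM normrX normw expr1n mul1r ger0_norm.
rewrite !normrZ normr_nat normrX (ger0_norm t_ge0) -(mulr_natl c).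
by rewrite ler_pM2l// ltr0n.
Qed.

(** * Coefficients of (1 + uB)^n A (1 - uB)^n as a polynomial in u *)

Lemma linear_iter (K : pzRingType) (V : lmodType K) (f : {linear V -> V}) n :
  linear (iter n f).
Proof. by elim: n => [//|n IHn] a x y; rewrite !iterS IHn linearP. Qed.

Lemma iter_commute T (f g : T -> T) n :
  f \o g =1 g \o f -> iter n f \o g =1 g \o iter n f.
Proof. by move=> fg x; elim: n => [//|n /= ->]; exact: fg. Qed.

Section PowerConjugation.
Variables (C : comNzRingType) (V : lmodType C) (B : {linear V -> V}).

Let E u : {linear V -> V} := [the {linear V -> V} of idfun \+ u \*: B].

(** Induction on n for all [A] at once, through the two factors next to [A]: (1 + uB) A (1 - uB) = A
    + u (BA - AB) - u^2 BAB. Each step thus adds one copy of (BA - AB) y to the coefficient of u. *)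
Lemma iter_conjugation_coef (A : {linear V -> V}) y n :
  exists v : nat -> V, [/\ v 0%N = A y, v 1%N = (B (A y) - A (B y)) *+ n &
    forall u N, (2 * n < N)%N ->
      iter n (fun x => x + u *: B x) (A (iter n (fun x => x - u *: B x) y)) =
      \sum_(i < N) u ^+ i *: v i].
Proof.
elim: n A => [|n IHn] A.
  exists (fun i => if i is 0%N then A y else 0); split=> // u [//|N] _.
  by rewrite big_ord_recl big1 ?addr0 ?scale1r// => i _; rewrite scaler0.
pose A1 := [the {linear V -> V} of (B \o A) \- (A \o B)].
pose A2 := [the {linear V -> V} of B \o A \o B].
have [a [a0 a1 aE]] := IHn A.
have [b [b0 b1 bE]] := IHn A1.
have [c [c0 c1 cE]] := IHn A2.
(* The factors u and u^2 shift the coefficients for [A1] and [A2] by one and two places; 0 fills the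
   places left empty. *)
exists (fun i => a i + (if i is i'.+1 then b i' else 0)
               - (if i is i'.+2 then c i' else 0)).
split; first by rewrite addr0 subr0.
  by rewrite a1 b0 subr0 mulrSr.
move=> u [//|[//|N]] nN.
have {}nN : (2 * n < N)%N by move: nN; rewrite mulnS !ltnS.
rewrite iterSr iterS; set x := iter n _ y.
have -> : A (x - u *: B x) + u *: B (A (x - u *: B x)) =
    u *: A1 x + (- u ^+ 2 *: A2 x + A x).
  have lin (F : {linear V -> V}) (z w : V) : F (z - u *: w) = F z - u *: F w.
    by rewrite linearB linearZ.
  have -> : B (A (x - u *: B x)) = B (A x) - u *: B (A (B x)).
    by rewrite (lin A) (lin B).
  rewrite (lin A) /= !scalerBr scalerA -expr2 scaleNr.
  by rewrite [LHS]addrC [RHS]addrACA [A x - _]addrC.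
rewrite (linear_iter (E u) n).
rewrite (linear_iter (E u) n).
(* The lengths N + 2, N + 1 and N compensate the shifts by 0, 1 and 2, so that the three sums
   recombine into one. *)
have nN1 := leqW nN; have nN2 := leqW nN1.
rewrite (aE u N.+2)// (bE u N.+1)// (cE u N)//.
under [RHS]eq_bigr do rewrite scalerBr scalerDr.
rewrite sumrB big_split /=.
have -> : \sum_(i < N.+2) u ^+ i *: (if nat_of_ord i is i'.+1 then b i' else 0)
    = u *: \sum_(i < N.+1) u ^+ i *: b i.
  rewrite big_ord_recl scaler0 add0r scaler_sumr.
  by apply: eq_bigr => i _; rewrite lift0 exprS scalerA.
have -> : \sum_(i < N.+2) u ^+ i *: (if nat_of_ord i is i'.+2 then c i' else 0)
    = u ^+ 2 *: \sum_(i < N) u ^+ i *: c i.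
  rewrite !big_ord_recl !scaler0 !add0r scaler_sumr.
  by apply: eq_bigr => i _; rewrite !lift0 scalerA -exprD.
by rewrite scaleNr addrCA [RHS]addrC [u *: _ + _]addrC.
Qed.

End PowerConjugation.

(** * Growth and norm estimates *)

(** Since (1 + s)(1 - (n + 1)s) <= 1 - ns, induction gives (1 + s)^n (1 - ns) <= 1, and here 1 - ns
    = 1/2. *)
Lemma bernoulli_le2 (F : numFieldType) (s : F) n :
  0 <= s -> s *+ n = 2^-1 -> (1 + s) ^+ n <= 2.
Proof.
move=> s_ge0 sn.
suff : (1 + s) ^+ n * (1 - s *+ n) <= 1.
  have -> : 1 - s *+ n = 2^-1 by rewrite sn; field.
  by rewrite ler_pdivrMr ?mul1r.
elim: n {sn} => [|n IHn]; first by rewrite mulr0n subr0 mulr1.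
apply: le_trans IHn; rewrite exprSr -mulrA ler_wpM2l ?exprn_ge0 ?addr_ge0//.
rewrite -subr_ge0 mulrS.
have -> : 1 - s *+ n - (1 + s) * (1 - (s + s *+ n)) = s * (s + s *+ n) by ring.
by rewrite mulr_ge0// addr_ge0// mulrn_wge0.
Qed.

Section Adjoint.
Variables (R : realType) (K : hilbertType R).
Implicit Types F G : K -> K.
Local Notation adjoint F G :=
  (forall x y, inner K (F x) y = inner K x (G y)).

(** Both squared norms equal the inner product of x with G F x = F G x. Bare functions are used so
    that the lemma applies to iterates. *)
Lemma normal_adjoint_norm F G :
  adjoint F G -> F \o G =1 G \o F -> forall x, `|F x| = `|G x|.
Proof.
move=> FG com x.
have GF y z : inner K (G y) z = inner K y (F z).
  by rewrite hermC /= -FG [RHS]hermC.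
apply: (@pexpIrn _ 2) => //; rewrite ?nnegrE//.
by rewrite !sqr_norm_inner FG -[G (F x)]/((G \o F) x) -com GF.
Qed.

Lemma iter_adjoint F G n : adjoint F G -> adjoint (iter n F) (iter n G).
Proof. by move=> FG; elim: n => [//|n IHn] x y; rewrite iterS FG IHn -iterSr. Qed.

Lemma iter_commute2 F G n :
  F \o G =1 G \o F -> iter n F \o iter n G =1 iter n G \o iter n F.
Proof.
by move=> FG; apply/iter_commute/fsym/iter_commute/fsym.
Qed.

End Adjoint.

(** The bound [m] supplied by [bounded_operatorP] is an arbitrary complex number; |m| + 1 is a
    positive one that still works. *)
Lemma bounded_operator_gt0 (R : realType) (K : hilbertType R)
    (A : bounded_operator K) : exists2 a, 0 < a & forall x, `|A x| <= a * `|x|.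
Proof.
have [m Am] := bounded_operatorP A; exists (`|m| + 1) => [|x].
  by rewrite ltr_pwDr.
have m_ge0 : 0 <= m * `|x| := le_trans (normr_ge0 _) (Am x).
apply: le_trans (Am x) _; rewrite -(ger0_norm m_ge0) normrM normr_id.
by rewrite ler_wpM2r// lerDl.
Qed.

(** The Archimedean property of [R], applied to real parts because [R[i]] is only partially
    ordered. *)
Lemma natmul_bounded_eq0 (R : realType) (d c : R[i]) :
  0 <= d -> (forall k : nat, d *+ k.+1 <= c) -> d = 0.
Proof.
move=> d_ge0 dc.
have dE : d = (complex.Re d)%:C%C.
  by rewrite RRe_real// ger0_real.
move: d_ge0; rewrite dE lecR le_eqVlt => /predU1P[<-//|d_gt0].
pose k := Num.truncn (complex.Re c / complex.Re d).
have : complex.Re c < complex.Re d *+ k.+1.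
  by rewrite -mulr_natl -ltr_pdivrMr// truncnS_gt.
have := dc k; rewrite lecE => /andP[_]; rewrite raddfMn /= => h1 h2.
by have := lt_le_trans h2 h1; rewrite ltxx.
Qed.

(** Commutation turns F^n G^n into (FG)^n, so the bound on FG is used n times. *)
Lemma iter_pair_norm (C : numDomainType) (V : normedModType C) (F G : V -> V)
    c n y :
  F \o G =1 G \o F -> 0 <= c -> (forall x, `|F (G x)| <= c * `|x|) ->
  `|iter n F (iter n G y)| <= c ^+ n * `|y|.
Proof.
move=> com c_ge0 FGc; elim: n => [|n IHn]; first by rewrite mul1r.
rewrite !iterS -[iter n F (G _)]/((iter n F \o G) _) iter_commute//=.
by apply: le_trans (FGc _) _; rewrite exprS -mulrA ler_wpM2l.
Qed.

(** * Fuglede's theorem *)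

Lemma fuglede (R : realType) (K : hilbertType R) (M B A : bounded_operator K) :
  is_adjoint M B -> M \o B =1 B \o M -> A \o M =1 M \o A -> A \o B =1 B \o A.
Proof.
move=> MB MBcom AM y /=; apply/esym/eqP; rewrite -subr_eq0 -normr_eq0.
set d := `|_|.
have [a a_gt0 aP] := bounded_operator_gt0 A.
have [b b_gt0 bP] := bounded_operator_gt0 B.
apply/eqP/(@natmul_bounded_eq0 _ _ (b * (a * (2 * `|y|)))) => [|k].
  exact: normr_ge0.
have [m mE m_gt0] : exists2 m : R[i], m = k.+1%:R & 0 < m.
  by exists k.+1%:R; rewrite ?ltr0n.
(* n (t b)^2 = 1/2 keeps (1 + (t b)^2)^n bounded while n t = k.+1 / b grows. *)
pose n := (2 * k.+1 ^ 2)%N; pose t : R[i] := (2 * m * b)^-1.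
have t_gt0 : 0 < t by rewrite invr_gt0 !mulr_gt0.
have tn : (t * b) ^+ 2 *+ n = 2^-1.
  by rewrite -mulr_natr /n /t natrM natrX -mE; field; rewrite !gt_eqF.
have bern : (1 + (t * b) ^+ 2) ^+ n <= 2.
  by apply: bernoulli_le2 tn; rewrite exprn_ge0// mulr_ge0// ltW.
have [v [_ v1 vE]] := iter_conjugation_coef B A y n.
have N1 : (1 < (2 * n).+1)%N by rewrite /n.
(* Cauchy's estimate for the coefficient of u on the circle of radius t; degree at most 2n means 2n
   + 1 coefficients. *)
have : t ^+ 1 * `|v 1%N| <= a * (2 * `|y|).
  apply: (@cauchy_coef_estimate _ _ _ v t _ (Ordinal N1)); first exact: ltW.
  move=> u ut; rewrite -vE//.
  have linE (L : {linear K -> K}) c x z : L (x + c *: z) = L x + c *: L z.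
    by rewrite linearD linearZ.
  (* [F] is the adjoint of [G]; it commutes with [A] because [M] does, which is not yet known of
     [G]. *)
  pose G x := x + u *: B x; pose F x := x + u^* *: M x.
  pose G' x := x - u *: B x.
  have FG_adj x z : inner K (F x) z = inner K x (G z).
    rewrite /F /G linearDl linearDr linearZl_LR linearZr_LR /=.
    by rewrite MB.
  have FGcom : F \o G =1 G \o F.
    move=> x; rewrite /F /G /= (linE M) (linE B) !scalerDr [LHS]addrACA.
    rewrite !scalerA [u * _]mulrC; congr (_ + (_ + _ *: _)).
    exact: MBcom.
  have FA x : F (A x) = A (F x).
    by rewrite /F (linE A) -[A (M x)]/((A \o M) x) AM.
  have norm_GF x : `|iter n G x| = `|iter n F x|.
    apply/esym/normal_adjoint_norm; first exact: iter_adjoint.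
    exact: iter_commute2.
  have GG'E x : G (G' x) = x - u ^+ 2 *: B (B x).
    rewrite /G /G' -scaleNr (linE B) scalerDr scaleNr scalerA mulrN scaleNr.
    by rewrite addrA subrK expr2.
  have GG'com : G \o G' =1 G' \o G.
    move=> x; rewrite /= GG'E /G /G' (linE B) scalerDr scalerA -expr2 opprD.
    by rewrite addrA addrK.
  have GG'_norm x : `|G (G' x)| <= (1 + (t * b) ^+ 2) * `|x|.
    rewrite GG'E.
    apply: le_trans (ler_normB _ _) _; rewrite mulrDl mul1r lerD2l.
    rewrite normrZ normrX ut exprMn -[leRHS]mulrA ler_wpM2l ?exprn_ge0 ?(ltW t_gt0)//.
    apply: le_trans (bP _) _; rewrite expr2 -[leRHS]mulrA ler_wpM2l ?(ltW b_gt0)//.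
  (* With z = G'^n y: |G^n A z| = |F^n A z| = |A F^n z| <= a |F^n z| = a |G^n z|, and then G^n G'^n
     = (1 - u^2 B^2)^n is estimated. *)
  rewrite -/G -/G' norm_GF -[iter n F (A _)]/((iter n F \o A) _) iter_commute//=.
  apply: le_trans (aP _) _; rewrite ler_wpM2l ?(ltW a_gt0)// -norm_GF.
  apply: le_trans (iter_pair_norm _ _ GG'com _ GG'_norm) _.
    by rewrite addr_ge0// exprn_ge0// mulr_ge0// ltW.
  by rewrite ler_wpM2r.
rewrite v1 normrMn -/d expr1 /t => dn.
have -> : d *+ k.+1 = b * (t * (d *+ n)).
  by rewrite -!(mulr_natr d) /t /n natrM natrX -!mE; field; rewrite !gt_eqF.
by rewrite ler_wpM2l// ltW.
Qed.

(** * Closed subspaces as Hilbert spaces *)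

Record closed_subspace (R : realType) (K : hilbertType R) := ClosedSubspace {
  subspace_pred :> {pred K};
  subspace_submod : submod_closed subspace_pred;
  subspace_closed : closed [set x | x \in subspace_pred]
}.

Section ClosedSubspace.
Variables (R : realType) (K : hilbertType R) (S : closed_subspace K).

HB.instance Definition _ :=
  GRing.isSubmodClosed.Build R[i] K (subspace_pred S)
    (GRing.submod_closed_semi (subspace_submod S)).

Inductive subspace_of : predArgType := SubspaceOf x & x \in subspace_pred S.

Definition subspace_val u := let: SubspaceOf x _ := u in x.

HB.instance Definition _ := [isSub for subspace_val].
HB.instance Definition _ := [Choice of subspace_of by <:].
HB.instance Definition _ := [SubChoice_isSubLmodule of subspace_of by <:].

Let norm (u : subspace_of) : R[i] := `|val u|.

Fact subspace_normD u v : norm (u + v) <= norm u + norm v.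
Proof. exact: ler_normD. Qed.

Fact subspace_normZ a u : norm (a *: u) = `|a| * norm u.
Proof. exact: normrZ. Qed.

Fact subspace_norm0_eq0 u : norm u = 0 -> u = 0.
Proof. by move=> /normr0_eq0 u0; apply: val_inj; rewrite /= u0. Qed.

HB.instance Definition _ := Lmodule_isNormed.Build R[i] subspace_of
  subspace_normD subspace_normZ subspace_norm0_eq0.

(** The image filter is Cauchy in [K] and converges there; closedness puts the limit in [S], and the
    norms agree, so convergence holds in the subspace too. *)
Fact subspace_complete (F : set_system subspace_of) :
  ProperFilter F -> cauchy F -> cvg F.
Proof.
move=> FF Fc.
have Fvc : cauchy (val @ F : set_system K).
  apply/cauchy_ballP => e e0.
  move/cauchy_ballP : Fc => /(_ e e0) [[A B] /= [FA FB] AB].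
  exists (val @` A, val @` B) => /=.
    split; [apply: filterS FA|apply: filterS FB] => x Ax /=; by exists x.
  move=> [_ _] /= [[x Ax <-] [y By <-]].
  have := AB (x, y) (conj Ax By).
  by rewrite -!ball_normE.
have [l Fl] : exists l : K, val @ F --> l by apply/cvg_ex; exact: cauchy_cvg.
have Sl : l \in subspace_pred S.
  have Sval : \forall u \near F, [set x | x \in subspace_pred S] (val u).
    by apply: nearW => x; exact: valP.
  exact: (closed_cvg _ (@subspace_closed _ _ S) Sval _ Fl).
apply/cvg_ex; exists (SubspaceOf Sl) => /=.
apply/cvgrPdist_lt => e e0.
by move/cvgrPdist_lt : Fl => /(_ e e0).
Qed.

HB.instance Definition _ :=
  Uniform_isComplete.Build subspace_of subspace_complete.

Definition subspace_inner (u v : subspace_of) := inner K (val u) (val v).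

Fact subspace_inner_bilinear :
  bilinear_for
    (GRing.Scale.Law.clone _ _ ( *%R ) _)
    (GRing.Scale.Law.clone _ _ (@Num.conj R[i] \; *%R ) _)
    subspace_inner.
Proof.
split=> u a v w /=; rewrite /subspace_inner /=.
  by rewrite linearDl linearZl_LR.
by rewrite linearDr linearZr_LR.
Qed.

HB.instance Definition _ :=
  bilinear_isBilinear.Build _ _ _ _ _ _ subspace_inner subspace_inner_bilinear.

Fact subspace_inner_hermitian u v :
  subspace_inner u v = (-1) ^+ false * (subspace_inner v u)^*.
Proof. exact: hermC. Qed.

HB.instance Definition _ :=
  isHermitianSesquilinear.Build _ _ _ _ subspace_inner
    subspace_inner_hermitian.

Fact subspace_inner_gt0 u : u != 0 -> 0 < subspace_inner u u.
Proof. by move=> u0; apply: neq0_dnorm_gt0. Qed.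

HB.instance Definition _ :=
  isDotProduct.Build _ _ subspace_inner subspace_inner_gt0.

Fact subspace_sqr_norm (u : subspace_of) : `|u| ^+ 2 = subspace_inner u u.
Proof. exact: sqr_norm_inner. Qed.

HB.instance Definition _ :=
  NormedModule_isHilbert.Build R subspace_of subspace_sqr_norm.

End ClosedSubspace.

(** * Restriction of operators to invariant closed subspaces *)

Section Corestriction.
Variables (R : realType) (K : hilbertType R) (S : closed_subspace K).
Variables (U : lmodType R[i]) (f : {linear U -> K}).
Hypothesis fS : forall x, f x \in subspace_pred S.

Definition corestrict x : subspace_of S := SubspaceOf (fS x).

Fact corestrict_linear : linear corestrict.
Proof. by move=> a x y; apply: val_inj; rewrite /= linearP. Qed.

HB.instance Definition _ :=
  GRing.isLinear.Build R[i] U (subspace_of S) *:%R corestrict corestrict_linear.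

End Corestriction.

Section Restriction.
Variables (R : realType) (K : hilbertType R) (S : closed_subspace K).

Definition invariant_subspace (A : K -> K) :=
  forall x, x \in subspace_pred S -> A x \in subspace_pred S.

Section BoundedOperator.
Variables (A : bounded_operator K) (AS : invariant_subspace A).

(** Phrased for the composite with the inclusion, so that [corestrict] makes the restriction
    linear. *)
Fact restrict_mem (u : subspace_of S) :
  [the {linear subspace_of S -> K} of bounded_operator_fun A \o val] u \in subspace_pred S.
Proof. exact/AS/valP. Qed.

Fact restrict_bounded :
  exists M : R[i], forall u, `|corestrict restrict_mem u| <= M * `|u|.
Proof. by have [M AM] := bounded_operatorP A; exists M => u; exact: AM. Qed.

Definition restrict : bounded_operator (subspace_of S) :=
  BoundedOperator restrict_bounded.

Lemma restrict_contraction : Defs.contraction A -> Defs.contraction restrict.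
Proof.
apply: le_trans; apply: sup_le.
- by move=> _ [u u1 <-]; apply: le_down; exists (val u).
- by exists (complex.Re `|restrict 0|), 0; rewrite //= normr0.
(* Comparing suprema requires the larger set to have one: it contains the value at 0 and is bounded
   since [A] is. *)
- split; first by exists (complex.Re `|A 0|), 0; rewrite //= normr0.
  have [a a_gt0 Aa] := bounded_operator_gt0 A.
  exists (complex.Re a) => _ [x /= x1 <-].
  have : `|A x| <= a by rewrite (le_trans (Aa x))// ler_piMr// ltW.
  by rewrite lecE => /andP[].
Qed.

End BoundedOperator.

(** Invariance under both operators makes the restriction of [B] the adjoint of that of [A];
    invariance under [A] alone would only yield a subnormal operator. *)
Lemma restrict_normal (A B : bounded_operator K)
    (AS : invariant_subspace A) (BS : invariant_subspace B) :
  is_adjoint A B -> A \o B =1 B \o A -> normal_operator (restrict AS).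
Proof.
move=> AB com; exists (restrict BS); split=> [u v|u]; first exact: AB.
by apply: val_inj; exact: com.
Qed.

End Restriction.

(** * The closed subspace on which the family is multiplicative *)

(** If D x were nonzero, the ball of radius |D x| / m around x would contain some y with D y = 0,
    whence |D x| = |D (x - y)| < |D x|. *)
Lemma closed_kernel (R : realType) (K : hilbertType R) (D : {linear K -> K}) m :
  0 < m -> (forall x, `|D x| <= m * `|x|) -> closed [set x | D x = 0].
Proof.
move=> m_gt0 Dm x clx /=; apply/eqP; rewrite -normr_eq0.
apply/negPn/negP => Dx0.
have Dx_gt0 : 0 < `|D x| by rewrite lt_def Dx0 /=.
have e_gt0 : 0 < `|D x| / m by rewrite divr_gt0.
have [y [/= Dy]] := clx _ (nbhsx_ballx x _ e_gt0).
rewrite -ball_normE /= ltr_pdivlMr// mulrC => xy.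
have := le_lt_trans (Dm (x - y)) xy.
by rewrite linearB Dy subr0 ltxx.
Qed.

Lemma closed_equalizer (R : realType) (K : hilbertType R)
    (f g : {linear K -> K}) a b :
  0 < a -> 0 < b ->
  (forall x, `|f x| <= a * `|x|) -> (forall x, `|g x| <= b * `|x|) ->
  closed [set x | f x = g x].
Proof.
move=> a_gt0 b_gt0 fa gb.
have -> : [set x | f x = g x] =
    [set x | [the {linear K -> K} of f \- g] x = 0].
  by apply/seteqP; split=> x /= => [->|/subr0_eq//]; rewrite subrr.
apply: (@closed_kernel _ _ _ (a + b)) => [|x]; first exact: addr_gt0.
by rewrite /= (le_trans (ler_normB _ _))// mulrDl lerD.
Qed.

Section Multiplicative.
Variables (R : realType) (P : monoidType) (K : hilbertType R).
Variable N : P -> bounded_operator K.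

Definition multiplicative_pred : {pred K} := fun x =>
  `[< N 1%g x = x /\ forall p q, N (p * q)%g x = N p (N q x) >].

Lemma multiplicative_predP x : reflect
  (N 1%g x = x /\ forall p q, N (p * q)%g x = N p (N q x))
  (x \in multiplicative_pred).
Proof. exact: asboolP. Qed.

Fact multiplicative_submod : submod_closed multiplicative_pred.
Proof.
split; first by apply/multiplicative_predP; split=> *; rewrite !linear0.
move=> a x y /multiplicative_predP[x1 xM] /multiplicative_predP[y1 yM].
by apply/multiplicative_predP; split=> *; rewrite !linearP ?x1 ?y1 ?xM ?yM.
Qed.

(** An intersection of equalizers of bounded operators, one for the unit and one for each pair (p,
    q). *)
Fact multiplicative_closed : closed [set x | x \in multiplicative_pred].
Proof.
have -> : [set x | x \in multiplicative_pred] =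
    [set x | N 1%g x = idfun x] `&`
    \bigcap_pq [set x | N (pq.1 * pq.2)%g x = (N pq.1 \o N pq.2) x].
  apply/seteqP; split=> x /=.
    by move=> /multiplicative_predP[x1 xM]; split=> // -[p q] _ /=.
  by move=> [x1 xM]; apply/multiplicative_predP; split=> // p q; exact: (xM (p, q)).
have bnd p := bounded_operator_gt0 (N p).
apply: closedI.
  have [a a_gt0 Na] := bnd 1%g.
  apply: (closed_equalizer a_gt0 (@ltr01 _) Na) => x.
  by rewrite mul1r.
apply: closed_bigI => -[p q] _ /=.
have [a a_gt0 Na] := bnd (p * q)%g.
have [b b_gt0 Nb] := bnd p; have [c c_gt0 Nc] := bnd q.
pose NpNq := [the {linear K -> K} of
  bounded_operator_fun (N p) \o bounded_operator_fun (N q)].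
have bc_gt0 := mulr_gt0 b_gt0 c_gt0.
apply: (@closed_equalizer _ _ _ NpNq _ _ a_gt0 bc_gt0 Na) => x /=.
by rewrite (le_trans (Nb _))// -mulrA ler_wpM2l// ltW.
Qed.

Definition multiplicative_subspace :=
  ClosedSubspace multiplicative_submod multiplicative_closed.

(** Applying [A] to the defining equations of a vector and moving it inward gives those of its
    image. This serves both the operators [N p] and their adjoints. *)
Lemma multiplicative_invariant A :
  (forall p, N p \o A =1 A \o N p) ->
  invariant_subspace multiplicative_subspace A.
Proof.
move=> com x /multiplicative_predP[x1 xM]; apply/multiplicative_predP.
have {}com p z : N p (A z) = A (N p z) by exact: com.
by split=> [|p q]; rewrite !com ?x1 ?xM.
Qed.

End Multiplicative.

Theorem theorem2p6 (R : realType) (P : monoidType)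
    (mulPC : forall p q : P, (p * q = q * p)%g)
    (H : hilbertType R) (T : P -> bounded_operator H)
    (T_rep : representation T) (T_contr : contractive T) :
  (exists (K : hilbertType R) (V : {linear H -> K})
      (N : P -> bounded_operator K),
      [/\ inclusion V, normal_family N, contractive N, commuting_family N
        & forall p, extends V (T p) (N p)])
  <->
  (exists (L : hilbertType R) (V : {linear H -> L})
      (N : P -> bounded_operator L),
      [/\ inclusion V, representation N, normal_family N, contractive N
        & forall p, extends V (T p) (N p)]).
Proof.
split=> [[K [V [N [Viso Nnormal Ncontr Ncomm NT]]]]|]; last first.
  (* From (ii) to (i) the same data serve: N(p)N(q) = N(pq) = N(qp) = N(q)N(p) as [P] is abelian. *)
  move=> [L [V [N [Viso [N1 NM] Nnormal Ncontr NT]]]].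
  exists L, V, N; split=> // p q x.
  by rewrite -NM mulPC NM.
have [N' N'adj] := choice Nnormal.
pose S := multiplicative_subspace N.
have NS p : invariant_subspace S (N p).
  by apply: multiplicative_invariant => q; exact: Ncomm.
have N'S p : invariant_subspace S (N' p).
  have [adj com] := N'adj p.
  (* Fuglede for the normal operator [N p] and the operator [N q] commuting with it. *)
  by apply: multiplicative_invariant => q; apply: (fuglede adj com); exact: Ncomm.
(* On the image of [H] the family acts as [T], so it inherits the multiplicativity of [T] there. *)
have VS h : V h \in subspace_pred S.
  have [T1 TM] := T_rep; apply/multiplicative_predP.
  by split=> [|p q]; rewrite !NT ?T1 ?TM.
exists (subspace_of S), (corestrict VS), (fun p => restrict (NS p)); split.
- by move=> h k; exact: Viso.
- split=> [u|p q u]; apply: val_inj => /=.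
    by have /multiplicative_predP[] := valP u.
  by have /multiplicative_predP[_ ->] := valP u.
- by move=> p; have [adj com] := N'adj p; exact: (restrict_normal _ (N'S p) adj com).
- by move=> p; exact/restrict_contraction/Ncontr.
- by move=> p h; apply: val_inj; exact: NT.
Qed.
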